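(* Let $\mathcal{H}$ be a real Hilbert space, let $T_i\colon\mathcal{H}\to\mathcal{H}$ be $\rho_i$-strongly quasinonexpansive for all $i\in\{1,\dots,n\}$, let $\omega_i>0$ for all $i\in\{1,\dots,n\}$ with $\sum_{i=1}^n\omega_i=1$, and let $T:=\sum_{i=1}^n\omega_iT_i$. Assume $\operatorname{Fix}T=\bigcap_{i=1}^n\operatorname{Fix}T_i\neq\emptyset$. Suppose that the following assertions hold. (i) The operator $T_i$ is boundedly Hölder regular for all $i\in\{1,\dots,n\}$. (ii) The collection $\{\operatorname{Fix}T_i\}_{i=1}^n$ is boundedly Hölder regular. Then $T$ is boundedly Hölder regular.
   Context: $\operatorname{Fix}S=\{u\in\mathcal{H}:S(u)=u\}$ and $\operatorname{d}(y,C)=\inf_{c\in C}\|y-c\|$. An operator $S\colon\mathcal{H}\to\mathcal{H}$ is $\rho$-strongly quasinonexpansive ($\rho$-SQNE) if $\rho>0$ and $\|S(x)-x^*\|^2+\rho\|x-S(x)\|^2\leq\|x-x^*\|^2$ for all $x\in\mathcal{H}$ and all $x^*\in\operatorname{Fix}S$. An operator $S\colon\mathcal{H}\to\mathcal{H}$ is Hölder regular on $U\subseteq\mathcal{H}$ if there exist $\kappa>0$ and $\gamma\in(0,1)$ such that $\operatorname{d}(y,\operatorname{Fix}S)\leq\kappa\|y-S(y)\|^{\gamma}$ for all $y\in U$. It is boundedly Hölder regular if it is Hölder regular on every bounded subset of $\mathcal{H}$ (constants may depend on the subset). A collection of sets $\{C_1,\dots,C_n\}$ in $\mathcal{H}$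 is Hölder regular on $U$ if there exist $\tau>0$ and $\theta\in(0,1)$ such that $\operatorname{d}(x,\bigcap_{i=1}^nC_i)\leq\tau\max_{i=1,\dots,n}\operatorname{d}(x,C_i)^{\theta}$ for all $x\in U$. It is boundedly Hölder regular if it is Hölder regular on every bounded subset of $\mathcal{H}$ (constants may depend on the subset). *)

(* Defs.v *)
From HB Require Import structures.
From mathcomp Require Import all_boot all_order all_algebra.
From mathcomp Require Import sesquilinear.
From mathcomp Require Import all_classical all_reals all_analysis.

Set Implicit Arguments.
Unset Strict Implicit.
Unset Printing Implicit Defensive.

Import Order.TTheory GRing.Theory Num.Theory.
Import numFieldNormedType.Exports.

Local Open Scope classical_set_scope.
Local Open Scope ring_scope.

Definition Fix (X : Type) (S : X -> X) : set X := [set u | S u = u].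

(* The infimum is real-valued, so [dist y set0 = 0] by the convention
   [inf set0 = 0]; the value is meaningful only for nonempty [C]. *)
Definition dist (R : realType) (H : normedModType R) (y : H) (C : set H) : R :=
  inf [set `|y - c| | c in C].

(* [norm_of_dot ip] says that the norm of [H] is the one induced by the inner
   product [ip]; for [H : completeNormedModType R] and [ip : {dot H for idfun}]
   (a symmetric positive definite bilinear form), it makes [H] a real Hilbert
   space. *)
Definition norm_of_dot (R : realType) (H : normedModType R)
    (ip : {dot H for idfun}) : Prop :=
  forall x : H, `|x| = Num.sqrt (ip x x).

Definition strongly_quasinonexpansive (R : realType) (H : normedModType R)
    (rho : R) (S : H -> H) : Prop :=
  0 < rho /\
  forall x xs : H, Fix S xs ->
    `|S x - xs| ^+ 2 + rho * `|x - S x| ^+ 2 <= `|x - xs| ^+ 2.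

Definition holder_regular_op (R : realType) (H : normedModType R)
    (U : set H) (S : H -> H) : Prop :=
  exists kappa gamma : R,
    [/\ 0 < kappa, 0 < gamma, gamma < 1 &
      forall y : H, U y -> dist y (Fix S) <= kappa * `|y - S y| `^ gamma].

Definition boundedly_holder_regular_op (R : realType) (H : normedModType R)
    (S : H -> H) : Prop :=
  forall U : set H, bounded_set U -> holder_regular_op U S.

(* All the terms of the maximum are nonnegative, so its default value 0 matters
   only for the empty family, [n = 0]. *)
Definition holder_regular_sets (R : realType) (H : normedModType R) (n : nat)
    (U : set H) (C : 'I_n -> set H) : Prop :=
  exists tau theta : R,
    [/\ 0 < tau, 0 < theta, theta < 1 &
      forall x : H, U x ->
        dist x (\bigcap_i C i)
          <= tau * \big[Num.max/0]_(i < n) (dist x (C i) `^ theta)].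

Definition boundedly_holder_regular_sets (R : realType) (H : normedModType R)
    (n : nat) (C : 'I_n -> set H) : Prop :=
  forall U : set H, bounded_set U -> holder_regular_sets U C.

Definition weighted_sum (R : realType) (H : normedModType R) (n : nat)
    (w : 'I_n -> R) (T : 'I_n -> H -> H) : H -> H :=
  fun x => \sum_(i < n) w i *: T i x.

(* Main.v *)
Require Import Defs.
From HB Require Import structures.
From mathcomp Require Import all_boot all_order all_algebra.
From mathcomp Require Import sesquilinear.
From mathcomp Require Import all_classical all_reals all_analysis.
From mathcomp Require Import ring lra.

Import Order.TTheory GRing.Theory Num.Theory.
Import numFieldNormedType.Exports.

Local Open Scope classical_set_scope.
Local Open Scope ring_scope.

(** Fix a common fixed point [z] and write [a = |x - z|], [b_i = |T_i x - z|],
    so that [b_i <= a] and, by the triangle inequality,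
    [a - \sum_i w_i b_i <= |x - T x|]. Each [w_i (a - b_i)] is a nonnegative
    part of the left-hand side, and strong quasinonexpansiveness gives
    [rho_i |x - T_i x|^2 <= (a - b_i) (a + b_i)]; hence on bounded sets
    [|x - T_i x|] is bounded by a multiple of [|x - T x|^(1/2)]. Chaining this
    with the Hoelder regularity of the [T_i] and of their fixed point sets
    gives the claim, with any exponent below all the [gamma_i theta / 2]. *)

Lemma dist_ge0 (R : realType) (H : normedModType R) (y : H) (C : set H) :
  0 <= dist y C.
Proof.
have [->|/set0P[c Cc]] := eqVneq C set0; first by rewrite /dist image_set0 inf0.
apply: lb_le_inf; first by exists `|y - c|; exists c.
by move=> _ [d _ <-]; exact: normr_ge0.
Qed.

(** On a bounded range an exponent can be lowered at the price of a constant factor: split off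
    [a ^ (p - q)] and bound it by its value at [B]. As [p > 0], the splitting also holds at
    [a = 0]. *)
Lemma powR_le_exponent {R : realType} (a B p q : R) :
  0 <= a -> a <= B -> 0 < q -> q <= p -> a `^ p <= B `^ (p - q) * a `^ q.
Proof.
move=> a0 aB q0 qp.
have p0 : 0 < p := lt_le_trans q0 qp.
have -> : a `^ p = a `^ (p - q) * a `^ q.
  by rewrite -powRD subrK// gt_eqF.
rewrite ler_wpM2r ?powR_ge0// ge0_ler_powR ?subr_ge0// nnegrE//.
exact: le_trans aB.
Qed.

Lemma min_exponent {R : realType} {n : nat} (p : 'I_n -> R) :
  (forall i, 0 < p i) ->
  exists q : R, [/\ 0 < q, q < 1 & forall i, q <= p i].
Proof.
(* The default [2^-1] takes part in the minimum, so it keeps the result below 1. *)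
move=> p0; exists (\big[Num.min/2^-1]_i p i); split.
- by apply/bigmin_gtP; split=> [|i _]; [rewrite invr_gt0|exact: p0].
- by apply: le_lt_trans (bigmin_le_id _ _ _ _) _; lra.
- by move=> i; exact: bigmin_inf (lexx _).
Qed.

Section WeightedSum.
Context {R : realType} {H : normedModType R} {n : nat}.
Variables (T : 'I_n -> H -> H) (w : 'I_n -> R).
Hypotheses (w_gt0 : forall i, 0 < w i) (w_sum1 : \sum_(i < n) w i = 1).

(** Convexity of the norm: since the weights sum to 1, [z] can be moved inside the sum. *)
Lemma norm_weighted_sum_le (x z : H) :
  `|weighted_sum w T x - z| <= \sum_(i < n) w i * `|T i x - z|.
Proof.
have -> : weighted_sum w T x - z = \sum_(i < n) w i *: (T i x - z).
  under [RHS]eq_bigr do rewrite scalerBr.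
  by rewrite sumrB -scaler_suml w_sum1 scale1r.
apply: le_trans (ler_norm_sum _ _ _) _.
by apply: ler_sum => i _; rewrite normrZ gtr0_norm.
Qed.

Variable rho : 'I_n -> R.
Hypothesis HT : forall i, strongly_quasinonexpansive (rho i) (T i).

Lemma sqne_norm_le (i : 'I_n) (x z : H) : Fix (T i) z ->
  `|T i x - z| <= `|x - z|.
Proof.
have [rho0 /[apply]/(_ x) h] := HT i.
rewrite -ler_sqr ?nnegrE ?normr_ge0//; apply: le_trans h.
by rewrite lerDl mulr_ge0 ?sqr_ge0 ?ltW.
Qed.

Lemma norm_weighted_sum_sqne_le (x z : H) : (\bigcap_i Fix (T i)) z ->
  `|weighted_sum w T x - z| <= `|x - z|.
Proof.
move=> Fz; apply: le_trans (norm_weighted_sum_le _ _) _.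
rewrite -[leRHS]mul1r -w_sum1 mulr_suml; apply: ler_sum => i _.
by rewrite ler_pM2l//; apply: sqne_norm_le; exact: Fz.
Qed.

Lemma sqne_residual_le (M : R) (x z : H) (i : 'I_n) :
  (\bigcap_i Fix (T i)) z -> `|x - z| <= M ->
  w i * rho i * `|x - T i x| ^+ 2 <= M *+ 2 * `|x - weighted_sum w T x|.
Proof.
move=> Fz xzM.
have ba j : `|T j x - z| <= `|x - z| by apply: sqne_norm_le; exact: Fz.
have a_le : `|x - z| <= `|x - weighted_sum w T x| + `|weighted_sum w T x - z|.
  by rewrite -[leLHS](_ : `|(x - weighted_sum w T x) +
      (weighted_sum w T x - z)| = _) ?ler_normD// addrA subrK.
have gap : w i * (`|x - z| - `|T i x - z|) <= `|x - weighted_sum w T x|.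
  have : \sum_(j < n) w j * (`|x - z| - `|T j x - z|) <=
      `|x - weighted_sum w T x|.
    under eq_bigr do rewrite mulrBr.
    rewrite sumrB -mulr_suml w_sum1 mul1r lerBlDr.
    by apply: le_trans a_le _; rewrite lerD2l norm_weighted_sum_le.
  apply: le_trans; rewrite (bigD1 i)//= lerDl; apply: sumr_ge0 => j _.
  by rewrite mulr_ge0 ?subr_ge0 ?ba// ltW.
have [_ /(_ x z (Fz i I)) sq] := HT i.
have := ba i; have := normr_ge0 (T i x - z).
move: sq gap xzM (w_gt0 i); rewrite !expr2 -(mulr_natl M).
set a := `|x - z|; set b := `|T i x - z|.
set d := `|x - weighted_sum w T x|; set c := `|x - T i x| * `|x - T i x|.
move=> sq gap aM wi0 b0 ba'.
(* The chain is [w_i rho_i c <= w_i (a - b) (a + b) <= w_i (a - b) 2M <= 2M d], where [a + b <= 2M]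
   because [b <= a <= M]. *)
have h1 : w i * (rho i * c) <= w i * ((a - b) * (a + b)).
  by rewrite ler_pM2l//; lra.
have h2 : w i * (a - b) * (a + b) <= w i * (a - b) * (2%:R * M).
  by rewrite ler_wpM2l//; [rewrite mulr_ge0 ?subr_ge0// ltW|lra].
have h3 : w i * (a - b) * (2%:R * M) <= d * (2%:R * M).
  by rewrite ler_wpM2r//; lra.
lra.
Qed.

Lemma dist_sqne_le (U : set H) (M : R) (z : H) (i : 'I_n) :
  (\bigcap_i Fix (T i)) z -> (forall x, U x -> `|x - z| <= M) ->
  holder_regular_op U (T i) ->
  exists K p : R, [/\ 0 <= K, 0 < p & forall x, U x ->
    dist x (Fix (T i)) <= K * `|x - weighted_sum w T x| `^ p].
Proof.
move=> Fz UM [k [g [k0 g0 _ reg]]].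
have [rho0 _] := HT i.
have wr0 : 0 < w i * rho i by rewrite mulr_gt0.
(* [c] is the constant in [|x - T_i x|^2 <= c |x - T x|]; raising this to the power [g / 2] bounds
   [|x - T_i x|^g]. *)
pose c := M *+ 2 / (w i * rho i).
exists (k * c `^ (g / 2)), (g / 2).
split=> [||x Ux]; [by rewrite mulr_ge0 ?powR_ge0 ?ltW|lra|].
apply: le_trans (reg _ Ux) _; rewrite -mulrA ler_pM2l//.
(* The sign of [M] is known only once [U] has a point. *)
have M0 : 0 <= M := le_trans (normr_ge0 _) (UM _ Ux).
have c0 : 0 <= c by rewrite divr_ge0 ?mulrn_wge0// ltW.
rewrite -powRM//.
have -> : `|x - T i x| `^ g = (`|x - T i x| ^+ 2) `^ (g / 2).
  by rewrite -powR_mulrn// -powRrM; congr (_ `^ _); field.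
have g20 : 0 <= g / 2 by rewrite ltW// divr_gt0.
apply: (ge0_ler_powR g20); rewrite ?nnegrE ?sqr_ge0 ?(mulr_ge0 c0)//.
rewrite /c mulrAC ler_pdivlMr// mulrC.
exact: sqne_residual_le Fz (UM _ Ux).
Qed.

End WeightedSum.

Theorem theorem4p9 (R : realType) (H : completeNormedModType R)
    (ip : {dot H for idfun}) (Hip : norm_of_dot ip)
    (n : nat) (T : 'I_n -> H -> H) (rho : 'I_n -> R)
    (HT : forall i : 'I_n, strongly_quasinonexpansive (rho i) (T i))
    (w : 'I_n -> R) (w_gt0 : forall i : 'I_n, 0 < w i)
    (w_sum1 : \sum_(i < n) w i = 1)
    (Fix_eq : Fix (weighted_sum w T) = \bigcap_i Fix (T i))
    (Fix_neq0 : \bigcap_i Fix (T i) !=set0)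
    (T_reg : forall i : 'I_n, boundedly_holder_regular_op (T i))
    (Fix_reg : boundedly_holder_regular_sets (fun i : 'I_n => Fix (T i))) :
  boundedly_holder_regular_op (weighted_sum w T).
Proof.
move=> U Ubd; have [z Fz] := Fix_neq0.
have [M UM] : exists M : R, forall x, U x -> `|x - z| <= M.
  have [N _ UN] := pinfty_ex_gt (num_real 0) Ubd.
  exists (N + `|z|) => x Ux; apply: le_trans (ler_normB _ _) _.
  by rewrite lerD2r; exact: UN.
have /choice[K /choice[p Kp]] i :=
  dist_sqne_le T w w_gt0 w_sum1 rho HT U M z i Fz UM (T_reg i _ Ubd).
have [tau [theta [tau0 theta0 theta1 reg]]] := Fix_reg _ Ubd.
have [|q [q0 q1 qp]] := min_exponent p; first by move=> i; have [] := Kp i.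
(* [L i] is the constant left after lowering the exponent [p i * theta] to the common [q * theta],
   using [|x - T x| <= 2M]. *)
pose L i := K i `^ theta * (M *+ 2) `^ (p i * theta - q * theta).
have L0 i : 0 <= L i by rewrite mulr_ge0 ?powR_ge0.
have sL0 : 0 <= \sum_i L i by exact: sumr_ge0.
(* The sum dominates every [L i], and the added 1 makes the constant positive even if all the [L i]
   vanish. *)
exists (tau * (1 + \sum_i L i)), (q * theta); split.
- by rewrite mulr_gt0// ltr_wpDr.
- exact: mulr_gt0.
- nra.
move=> x Ux; rewrite Fix_eq; apply: le_trans (reg _ Ux) _.
rewrite -mulrA ler_pM2l//; set a := `|_|.
have a0 : 0 <= a by exact: normr_ge0.
(* Pass through [z]: the averaged operator does not increase the distance to a common fixed
   point. *)
have aM : a <= M *+ 2.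
  rewrite /a -(subrKA z) (le_trans (ler_normD _ _))// mulr2n lerD ?UM//.
  rewrite distrC; apply: le_trans (UM _ Ux).
  exact: norm_weighted_sum_sqne_le HT _ _ Fz.
apply/bigmax_leP; split=> [|i _].
  by rewrite mulr_ge0 ?powR_ge0// addr_ge0.
have [K0 p0 dK] := Kp i.
have dle : dist x (Fix (T i)) `^ theta <= (K i * a `^ p i) `^ theta.
  apply: (ge0_ler_powR (ltW theta0)) (dK _ Ux); rewrite nnegrE ?dist_ge0//.
  by rewrite mulr_ge0 ?powR_ge0.
apply: le_trans dle _; rewrite powRM ?powR_ge0// -powRrM.
have : a `^ (p i * theta) <=
    (M *+ 2) `^ (p i * theta - q * theta) * a `^ (q * theta).
  by apply: powR_le_exponent => //; [exact: mulr_gt0|rewrite ler_pM2r].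
move=> /(ler_wpM2l (powR_ge0 (K i) theta)) /le_trans; apply.
rewrite mulrA ler_wpM2r ?powR_ge0// (bigD1 i)//= -/(L i).
have : 0 <= \sum_(j < n | j != i) L j by exact: sumr_ge0.
lra.
Qed.
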